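(* Let $\delta,H,D>0$. Let $(X,d)$ be a $\delta$-hyperbolic metric space and let $\Gamma$ be a group which is not virtually cyclic, acting properly by isometries on $(X,d)$ with $\operatorname{diam}(\Gamma\backslash X)\le D$ and $\operatorname{Ent}(X,d)\le H$. Then every element $\gamma\in\Gamma\setminus\{e\}$ of infinite order satisfies $$\ell(\gamma)>\frac{2(5D+\delta)}{\nu\big(3^5e^{73H(D+4\delta)}\big)+2}.$$
   Context: A metric space is $\delta$-hyperbolic if it is proper, geodesic, and every geodesic triangle is $\delta$-thin: for a geodesic triangle $\Delta=[x,y,z]$ let $T_\Delta$ be the metric tripod with branch lengths $\alpha,\beta,\gamma\ge0$ determined by $d(x,y)=\alpha+\beta$, $d(x,z)=\alpha+\gamma$, $d(y,z)=\beta+\gamma$, and $f_\Delta:\Delta\to T_\Delta$ the map which is an isometry on each side; $\Delta$ is $\delta$-thin if any two points with the same image under $f_\Delta$ are at distance $\le\delta$. An isometric action is proper if for every $R>0$, $x\in X$, the set $\{\gamma: d(x,\gamma x)\le R\}$ is finite; $\operatorname{diam}(\Gamma\backslash X)$ is taken for the quotient distance $\bar d(\Gamma x,\Gamma y)=\inf_\gamma d(x,\gamma y)$. The entropy is $\operatorname{Ent}(X,d)=\liminf_{R\to\infty}\frac1R\ln\#\{\gamma\in\Gamma: d(x,\gamma x)<R\}$ (independent of $x$). The asymptotic displacement of an isometry $\gamma$ is $\ell(\gamma)=\lim_{k\to+\infty}\frac1k d(x,\gamma^kx)$ (independent of $x$). The function $\nu:[1,\infty)\to\mathbf N^*$ is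 the nondecreasing universal function of Breuillard–Green–Tao: for every $K\ge1$ there is $\nu'(K)\in\mathbf N^*$ such that whenever $A,B$ are finite nonempty subsets of a group $G$ with $\#(A\cdot B)\le K(\#A)^{1/2}(\#B)^{1/2}$, there exist a subgroup $G_0\le G$ and a finite normal subgroup $L\trianglelefteq G_0$ such that $A$ is covered by $\nu(K)$ left translates of $G_0$ and $G_0/L$ is nilpotent with a generating set of fewer than $\nu'(K)$ elements. *)

(* Defs.v *)
From HB Require Import structures.
From mathcomp Require Import all_boot all_order all_algebra.
From mathcomp Require Import all_classical all_reals all_analysis.
From Stdlib Require List.

Set Implicit Arguments.
Unset Strict Implicit.
Unset Printing Implicit Defensive.

Import Order.TTheory GRing.Theory Num.Theory.
Import numFieldNormedType.Exports.
Local Open Scope classical_set_scope.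
Local Open Scope ring_scope.

Record group := Group {
  gcar :> Type;
  gmul : gcar -> gcar -> gcar;
  gone : gcar;
  ginv : gcar -> gcar;
  gmulA : forall x y z, gmul x (gmul y z) = gmul (gmul x y) z;
  gmul1g : forall x, gmul gone x = x;
  gmulVg : forall x, gmul (ginv x) x = gone }.

Section GroupDefs.
Variable G : group.

Fixpoint gpow (g : G) (n : nat) : G :=
  if n is n'.+1 then gmul g (gpow g n') else gone G.

Definition gzpow (g : G) (k : int) : G :=
  match k with Posz n => gpow g n | Negz n => ginv (gpow g n.+1) end.

Definition gcomm (a b : G) : G := gmul (gmul (ginv a) (ginv b)) (gmul a b).

Definition is_subgroup (H : set G) : Prop :=
  H (gone G) /\ (forall x y, H x -> H y -> H (gmul x y)) /\
  (forall x, H x -> H (ginv x)).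

Definition gen (S : set G) : set G :=
  [set g | forall K, is_subgroup K -> S `<=` K -> K g].

Definition prodset (A B : set G) : set G :=
  [set g | exists a b, A a /\ B b /\ g = gmul a b].

Definition normal_in (L G0 : set G) : Prop :=
  is_subgroup L /\ L `<=` G0 /\
  forall g l, G0 g -> L l -> L (gmul (gmul g l) (ginv g)).

(* preimages in G0 of the lower central series of G0/L :
   C_0 = G0, C_{n+1} = < L, [C_n, G0] >  *)
Fixpoint lcs_mod (G0 L : set G) (n : nat) : set G :=
  if n is n'.+1 then
    gen (L `|` [set g | exists a b, lcs_mod G0 L n' a /\ G0 b /\ g = gcomm a b])
  else G0.

Definition nilpotent_mod (G0 L : set G) : Prop := exists n, lcs_mod G0 L n `<=` L.

Definition quot_gen_lt (G0 L : set G) (m : nat) : Prop :=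
  exists S : seq G, (size S < m)%N /\ (forall s, List.In s S -> G0 s) /\
    G0 `<=` gen (L `|` [set s | List.In s S]).

Definition covered_by_translates (A G0 : set G) (n : nat) : Prop :=
  exists ts : seq G, size ts = n /\
    forall a, A a -> exists t g, List.In t ts /\ G0 g /\ a = gmul t g.

Definition virtually_cyclic : Prop :=
  exists (g : G) (reps : seq G),
    forall h, exists r k, List.In r reps /\ h = gmul r (gzpow g k).

Definition infinite_order (g : G) : Prop := forall n, (0 < n)%N -> gpow g n <> gone G.

End GroupDefs.

Definition card_is {T : Type} (P : set T) (n : nat) : Prop :=
  exists l : seq T, List.NoDup l /\ (forall z, P z <-> List.In z l) /\ size l = n.

Definition finite_pred {T : Type} (P : set T) : Prop := exists n, card_is P n.

(* number of elements of a finite set (0 if infinite) *)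
Definition ncard {T : Type} (P : set T) : nat :=
  match pselect (exists n, card_is P n) with
  | left h => proj1_sig (cid h)
  | right _ => 0%N
  end.

Definition BGT_function {R : realType} (nu : R -> nat) : Prop :=
  (forall K K', 1 <= K -> K <= K' -> (nu K <= nu K')%N) /\
  (forall K, 1 <= K -> (0 < nu K)%N) /\
  (forall K, 1 <= K -> exists nu' : nat, (0 < nu')%N /\
     forall (G : group) (A B : set G) (a b : nat),
       card_is A a -> card_is B b -> (0 < a)%N -> (0 < b)%N ->
       (exists c : nat, card_is (prodset A B) c /\
          c%:R <= K * Num.sqrt (a%:R) * Num.sqrt (b%:R)) ->
       exists G0 L : set G,
         is_subgroup G0 /\ normal_in L G0 /\ finite_pred L /\
         covered_by_translates A G0 (nu K) /\
         nilpotent_mod G0 L /\ quot_gen_lt G0 L nu').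

Section Metric.
Variables (R : realType) (X : Type) (d : X -> X -> R).

Definition is_metric : Prop :=
  (forall x y, 0 <= d x y) /\ (forall x y, d x y = 0 <-> x = y) /\
  (forall x y, d x y = d y x) /\ (forall x y z, d x z <= d x y + d y z).

(* proper: closed balls are compact (sequential compactness) *)
Definition proper_metric : Prop :=
  forall (x : X) (r : R) (u : nat -> X), (forall n, d x (u n) <= r) ->
    exists (phi : nat -> nat) (y : X),
      (forall n, (phi n < phi n.+1)%N) /\
      (fun n => d (u (phi n)) y) @ \oo --> (0 : R).

Definition is_geod (c : R -> X) (x y : X) : Prop :=
  c 0 = x /\ c (d x y) = y /\
  forall s t, 0 <= s <= d x y -> 0 <= t <= d x y -> d (c s) (c t) = `|s - t|.

Definition geodesic_space : Prop := forall x y, exists c, is_geod c x y.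

(* Points of the metric tripod: (branch index, distance to the centre);
   branches 0,1,2 correspond to the vertices x,y,z. *)
Definition tripod_eq (p q : nat * R) : Prop :=
  p.2 = q.2 /\ (p.2 = 0 \/ p.1 = q.1).

Section Triangle.
Variables (x y z : X) (cxy cxz cyz : R -> X).
Let alpha := (d x y + d x z - d y z) / 2.
Let beta := (d x y + d y z - d x z) / 2.

(* sides: 0 = [x,y] (from x), 1 = [x,z] (from x), 2 = [y,z] (from y) *)
Definition tri_side (k : nat) : R -> X :=
  match k with 0%N => cxy | 1%N => cxz | _ => cyz end.
Definition tri_len (k : nat) : R :=
  match k with 0%N => d x y | 1%N => d x z | _ => d y z end.
(* the map f_Delta, isometric on each side *)
Definition tri_f (k : nat) (t : R) : nat * R :=
  match k with
  | 0%N => if t <= alpha then (0%N, alpha - t) else (1%N, t - alpha)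
  | 1%N => if t <= alpha then (0%N, alpha - t) else (2%N, t - alpha)
  | _ => if t <= beta then (1%N, beta - t) else (2%N, t - beta)
  end.

Definition thin_triangle (delta : R) : Prop :=
  forall k l s t, (k < 3)%N -> (l < 3)%N ->
    0 <= s <= tri_len k -> 0 <= t <= tri_len l ->
    tripod_eq (tri_f k s) (tri_f l t) ->
    d (tri_side k s) (tri_side l t) <= delta.
End Triangle.

Definition hyperbolic (delta : R) : Prop :=
  is_metric /\ proper_metric /\ geodesic_space /\
  forall x y z cxy cxz cyz, is_geod cxy x y -> is_geod cxz x z -> is_geod cyz y z ->
    thin_triangle x y z cxy cxz cyz delta.

Variable G : group.
Variable act : G -> X -> X.

Definition isometric_action : Prop :=
  (forall p, act (gone G) p = p) /\
  (forall g h p, act (gmul g h) p = act g (act h p)) /\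
  (forall g p q, d (act g p) (act g q) = d p q).

Definition proper_action : Prop :=
  forall (r : R) (p : X), 0 < r -> finite_pred [set g : G | d p (act g p) <= r].

Local Open Scope ereal_scope.
Definition qdist (p q : X) : \bar R := ereal_inf [set (d p (act g q))%:E | g in [set: G]].
Definition quot_diam : \bar R := ereal_sup [set qdist p q | p in [set: X] & q in [set: X]].

Definition entropy (p : X) : \bar R :=
  limf_einf (fun r : R => (ln ((ncard [set g : G | d p (act g p) < r])%:R) / r)%:E)
            (pinfty_nbhs R).
Local Close Scope ereal_scope.

Definition displacement (p : X) (g : G) : R :=
  limn (fun k : nat => d p (act (gpow g k) p) / k%:R).
End Metric.

(* Main.v *)
(** Write [l] for the displacement of [g], [N r] for the number of group elements
moving a base point [x] by at most [r], and call [commens g] the commensurator of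
the cyclic group generated by [g].  Hyperbolicity enters only through the
four-point inequality and the existence of geodesics.

- Axis.  If [m] maximises [d p (g^m p) - m (l + e)], the midpoint of [p, g^m p] is
  moved by every [g^k] at most [k (l + e) + 4 delta].  By cocompactness and
  properness [e] can be taken to be [0] for a suitable point [x], at the cost of a
  constant; in particular [l > 0], as the powers of [g] would otherwise all lie in
  a finite set.
- Commensurator.  If [s] commensurates [g], then [s x] is almost between
  [g^-k x] and [g^k x] for large [k], hence close to the orbit of [x] under [g].
  So [g] generates a subgroup of finite index in [commens g], and as the group is
  not virtually cyclic, some [s] of small displacement lies outside [commens g].
  A subgroup that is nilpotent modulo a finite normal subgroup and contains a
  nontrivial power of [g] lies in [commens g].
- Doubling.  If [N (2r)] exceeded [3^5 exp(kap) N r], then at some intermediate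
  scale [rho] a third of the elements of the ball of radius [rho] would lie near
  its boundary and point away from any given direction; concatenating such
  elements is injective up to [N r], whence [N (n rho) >= exp(kap n)] for all [n],
  which contradicts the entropy bound.
- Conclusion.  The Breuillard-Green-Tao property applied to the ball of radius [r]
  covers it by [nu] cosets of such a nilpotent-by-finite subgroup [G0].  If [l] were
  small, the ball would contain [nu + 1] consecutive powers [g^k], as well as the
  elements [g^k s], so by the pigeonhole principle [G0], hence [commens g], would
  contain both a power of [g] and a conjugate by [s] of a power of [g], forcing [s]
  into [commens g]. *)
Require Import Defs.
From HB Require Import structures.
From mathcomp Require Import all_boot all_order all_algebra.
From mathcomp Require Import all_classical all_reals all_analysis.
From mathcomp Require Import zify ring lra.
From Stdlib Require List.
Import Order.TTheory GRing.Theory Num.Theory.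
Import numFieldNormedType.Exports.
Local Open Scope classical_set_scope.
Local Open Scope ring_scope.

Set Implicit Arguments.
Unset Strict Implicit.
Unset Printing Implicit Defensive.

(** * Finite sets *)

Lemma In_mem (T : eqType) (x : T) (s : seq T) : List.In x s <-> x \in s.
Proof.
elim: s => //= y s IH; rewrite inE; split.
  by move=> [->|/IH ->]; rewrite ?eqxx ?orbT.
by move=> /orP[/eqP ->|/IH]; [left|right].
Qed.

Lemma NoDup_uniq (T : eqType) (s : seq T) : List.NoDup s <-> uniq s.
Proof.
elim: s => [|x s IH] /=; first by split => // _; constructor.
split; first by move=> /List.NoDup_cons_iff[xs /IH ->]; rewrite andbT; apply/negP => /In_mem.
by move=> /andP[/negP xs /IH ns]; constructor => // /In_mem.
Qed.

Lemma card_isP (T : Type) (P : set T) n : card_is P n <->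
  exists s : seq {classic T}, [/\ uniq s, forall z, P z <-> z \in s & size s = n].
Proof.
split=> [[s [ns [sP sn]]]|[s [us sP sn]]]; exists s.
  by split => //; [exact/NoDup_uniq | move=> z; rewrite -In_mem].
split; first exact/(@NoDup_uniq {classic T}).
by split => // z; rewrite sP (@In_mem {classic T}).
Qed.

Lemma ncardE (T : Type) (P : set T) n : card_is P n -> ncard P = n.
Proof.
move=> /[dup] Pn /card_isP[s [us sP <-]]; rewrite /ncard.
case: pselect => [e|[]]; last by exists n.
case: cid => /= m /card_isP[s' [us' s'P <-]]; apply: perm_size.
by apply: uniq_perm => // z; apply/idP/idP => [/s'P/sP|/sP/s'P].
Qed.

(** Pairs [(g, h)] related by [r] are counted along rows and along columns. It serves to count
    products when multiplication is at most [m] to one. *)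
Lemma double_count (T : eqType) (W I : seq T) (r : rel T) o m :
  {in W, forall g, o <= count (r g) I}%N ->
  {in I, forall h, count (r^~ h) W <= m}%N ->
  (o * size W <= m * size I)%N.
Proof.
move=> hW hI; rewrite -!sum1_size !big_distrr /=.
apply: (@leq_trans (\sum_(g <- W) count (r g) I)).
  by rewrite !(big_seq_cond xpredT); apply: leq_sum => g /andP[/hW]; rewrite muln1.
under eq_bigr do rewrite -sum1_count big_mkcond.
rewrite exchange_big /= !(big_seq_cond xpredT).
apply: leq_sum => h /andP[/hI hm _]; rewrite -big_mkcond sum1_count.
by rewrite muln1.
Qed.

(** * Groups and commensurators *)

Section GroupTheory.
Variable G : group.
Implicit Types g h x y z : G.

Local Notation "x ** y" := (gmul x y) (at level 40, left associativity).
Local Notation e1 := (gone G).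

Lemma gmulKV x y : ginv x ** (x ** y) = y.
Proof. by rewrite gmulA gmulVg gmul1g. Qed.

Lemma gmulgV x : x ** ginv x = e1.
Proof.
by rewrite -[LHS](gmulKV (ginv x)) (gmulA (ginv x) x) gmulVg gmul1g gmulVg.
Qed.

Lemma gmulg1 x : x ** e1 = x.
Proof. by rewrite -(gmulVg x) gmulA gmulgV gmul1g. Qed.

Lemma gmulVK x y : x ** (ginv x ** y) = y.
Proof. by rewrite gmulA gmulgV gmul1g. Qed.

Lemma gmulIg x y z : x ** y = x ** z -> y = z.
Proof. by move=> e; rewrite -(gmulKV x y) e gmulKV. Qed.

Lemma ginv_uniq x y : x ** y = e1 -> ginv x = y.
Proof. by move=> e; apply: (@gmulIg x); rewrite e gmulgV. Qed.

Lemma ginvK x : ginv (ginv x) = x.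
Proof. exact/ginv_uniq/gmulVg. Qed.

Lemma ginvM x y : ginv (x ** y) = ginv y ** ginv x.
Proof. by apply: ginv_uniq; rewrite -gmulA gmulVK gmulgV. Qed.

Lemma ginv1 : ginv e1 = e1.
Proof. exact/ginv_uniq/gmul1g. Qed.

Lemma gpowSr g n : gpow g n.+1 = gpow g n ** g.
Proof.
elim: n => [|n IH] /=; first by rewrite gmul1g gmulg1.
by rewrite -gmulA -IH.
Qed.

Lemma gzpowS g (k : int) : gzpow g (k + 1) = gzpow g k ** g.
Proof.
case: k => n; first by rewrite -PoszD addn1 /= -gpowSr.
case: n => [|n]; first by rewrite /= gmulg1 gmulVg.
have -> : Negz n.+1 + 1 = Negz n by lia.
rewrite -[gzpow g (Negz n.+1)]/(ginv (g ** gpow g n.+1)) ginvM.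
by rewrite -gmulA gmulVg gmulg1.
Qed.

Lemma gzpowB1 g (k : int) : gzpow g (k - 1) = gzpow g k ** ginv g.
Proof.
have e : k = (k - 1) + 1 by lia.
by rewrite {2}e gzpowS -gmulA gmulgV gmulg1.
Qed.

Lemma int_ind_pm (P : int -> Prop) :
  P 0 -> (forall k, P k -> P (k + 1)) -> (forall k, P k -> P (k - 1)) ->
  forall k, P k.
Proof.
move=> P0 Pp Pm [n|n].
  elim: n => [//|n IH]; have -> : Posz n.+1 = Posz n + 1 by lia.
  exact: Pp.
elim: n => [|n IH]; first exact: (Pm 0).
have -> : Negz n.+1 = Negz n - 1 by lia.
exact: Pm.
Qed.

Lemma gzpowD g (k l : int) : gzpow g (k + l) = gzpow g k ** gzpow g l.
Proof.
elim/int_ind_pm: l => [|l IH|l IH]; first by rewrite addr0 gmulg1.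
  by rewrite addrA !gzpowS IH gmulA.
by rewrite addrA !gzpowB1 IH gmulA.
Qed.

Lemma gzpowN g (k : int) : gzpow g (- k) = ginv (gzpow g k).
Proof. by apply/esym/ginv_uniq; rewrite -gzpowD subrr. Qed.

Lemma gzpowM g (k l : int) : gzpow g (k * l) = gzpow (gzpow g k) l.
Proof.
elim/int_ind_pm: l => [|l IH|l IH]; first by rewrite mulr0.
  by rewrite (gzpowS (gzpow g k)) -IH mulrDr mulr1 gzpowD.
by rewrite (gzpowB1 (gzpow g k)) -IH mulrBr mulr1 gzpowD gzpowN.
Qed.

Lemma gzpow_conj g h (k : int) :
  gzpow (h ** g ** ginv h) k = h ** gzpow g k ** ginv h.
Proof.
elim/int_ind_pm: k => [|k IH|k IH]; first by rewrite /= gmulg1 gmulgV.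
  by rewrite !gzpowS IH -!gmulA gmulKV.
by rewrite !gzpowB1 IH !ginvM ginvK -!gmulA gmulKV.
Qed.

Lemma gzpow_neq1 g (k : int) : infinite_order g -> k != 0 -> gzpow g k <> e1.
Proof.
move=> oo; case: k => [[|n]|n] //= _; first exact: (oo n.+1).
move=> e; apply: (oo n.+1) => //=.
by rewrite -[LHS]ginvK e ginv1.
Qed.

Lemma gpow_gzpow g (k : int) n : gpow (gzpow g k) n = gzpow g (k * n%:Z).
Proof. by rewrite gzpowM. Qed.

Lemma gzpow_infinite_order g (k : int) :
  infinite_order g -> k != 0 -> infinite_order (gzpow g k).
Proof.
move=> oo k0 n n0; rewrite gpow_gzpow.
by apply: gzpow_neq1 => //; rewrite mulf_neq0 //; case: n n0.
Qed.

Lemma conj_infinite_order g h :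
  infinite_order g -> infinite_order (h ** g ** ginv h).
Proof.
move=> oo n n0 e; apply: (oo n n0).
have := gzpow_conj g h n; rewrite /= e => /esym e'.
apply: (@gmulIg h); rewrite gmulg1.
by rewrite -[LHS]gmulg1 -(gmulVg h) gmulA e' gmul1g.
Qed.

Lemma gen_min (S K : set G) : is_subgroup K -> S `<=` K -> gen S `<=` K.
Proof. by move=> sK SK g; apply. Qed.

Lemma gen_sub (S : set G) : S `<=` gen S.
Proof. by move=> g Sg K _; apply. Qed.

Lemma pigeonhole_In (T : Type) (f : nat -> T) (s : seq T) n :
  (size s < n)%N -> (forall i, (i < n)%N -> List.In (f i) s) ->
  exists i j, [/\ (i < j)%N, (j < n)%N & f i = f j].
Proof.
move=> sn fs; pose T' := {classic T}; pose f' : nat -> T' := f.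
have nuniq : ~~ uniq (mkseq f' n).
  apply/negP => u; move: sn; rewrite ltnNge => /negP; apply.
  rewrite -(size_mkseq f' n); apply: (uniq_leq_size u) => x /mapP[i].
  by rewrite mem_iota add0n => /andP[_ /fs fi] ->; apply/In_mem.
have [i [j [ij jn e]]] := uniqPn (f' 0%N) nuniq.
rewrite size_mkseq in jn; exists i, j; split => //.
by move: e; rewrite !nth_mkseq // (ltn_trans ij jn).
Qed.

Lemma covered_pigeonhole (A G0 : set G) n (f : nat -> G) :
  is_subgroup G0 -> covered_by_translates A G0 n ->
  (forall i, (i <= n)%N -> A (f i)) ->
  exists i j, [/\ (i < j)%N, (j <= n)%N & G0 (ginv (f i) ** f j)].
Proof.
move=> [_ [G0M G0V]] [ts [tsn cov]] fA.
have ex i : exists t, (i <= n)%N -> List.In t ts /\ exists2 h, G0 h & f i = t ** h.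
  have [/fA/cov[t [h [tts [G0h e]]]]|ni] := leqP i n; last by exists e1.
  by exists t => _; split => //; exists h.
have [t tP] := choice ex.
have [i [j [ij jn e]]] : exists i j, [/\ (i < j)%N, (j < n.+1)%N & t i = t j].
  by apply: (@pigeonhole_In _ t ts) => [|i]; rewrite ?tsn // ltnS => /tP[].
exists i, j; split => //.
have [_ [h G0h ->]] := tP _ (leq_trans (ltnW ij) jn).
have [_ [h' G0h' ->]] := tP _ jn.
by rewrite ginvM e -gmulA gmulKV; apply: G0M => //; apply: G0V.
Qed.

(** For [g] of infinite order this is the commensurator of the subgroup generated by [g]: two
    infinite cyclic subgroups are commensurable as soon as they share a nontrivial element. *)
Definition commens g : set G :=
  [set s | exists p q : int, [/\ p != 0, q != 0 &
     s ** gzpow g p ** ginv s = gzpow g q]].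

Lemma commens_subgroup g : is_subgroup (commens g).
Proof.
split; [|split].
- by exists 1, 1; split => //; rewrite ginv1 gmulg1 gmul1g.
- move=> s t [p [q [p0 q0 e]]] [p' [q' [p'0 q'0 e']]].
  exists (p' * p), (q' * q); split; try by rewrite mulf_neq0.
  have -> : s ** t ** gzpow g (p' * p) ** ginv (s ** t) =
     s ** (t ** gzpow g (p' * p) ** ginv t) ** ginv s.
    by rewrite ginvM !gmulA.
  rewrite (gzpowM g p' p) -gzpow_conj e' -gzpowM [q' * p]mulrC.
  by rewrite (gzpowM g p q') -gzpow_conj e -gzpowM mulrC.
- move=> s [p [q [p0 q0 e]]]; exists q, p; split => //.
  by rewrite -e ginvK -!gmulA gmulVg gmulg1 gmulKV.
Qed.

Lemma commens_gzpow g (k : int) : commens g (gzpow g k).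
Proof.
exists 1, 1; split => //.
by rewrite -gzpowN -!gzpowD; congr gzpow; lia.
Qed.

Lemma gzpow_conj_commens g s (p : int) :
  p != 0 -> (exists q n : int, [/\ q != 0, n != 0 &
    gzpow (s ** gzpow g p ** ginv s) n = gzpow g q]) -> commens g s.
Proof.
move=> p0 [q [n [q0 n0 e]]]; exists (p * n), q; split => //.
  by rewrite mulf_neq0.
by rewrite gzpowM -gzpow_conj.
Qed.

Section VirtuallyCyclicCommensurator.
Variable g : G.
Hypothesis g_oo : infinite_order g.
Variable F : seq G.
Hypothesis F_cover :
  forall s, commens g s -> exists (k : int) f, List.In f F /\ s = gzpow g k ** f.

(** Modulo left multiplication by powers of [g], the powers of [a] take finitely many values, so two
    of them differ by a power of [g]; it is nontrivial because [a] has infinite order. *)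
Lemma commens_power a : commens g a -> infinite_order a ->
  exists q n : int, [/\ q != 0, n != 0 & gzpow a n = gzpow g q].
Proof.
move=> Ea a_oo.
have Ep (i : nat) : exists f, List.In f F /\ exists k : int, gpow a i = gzpow g k ** f.
  have [|k [f [Ff e]]] := @F_cover (gpow a i); last by exists f; split => //; exists k.
  have [E1 [EM _]] := commens_subgroup g.
  by elim: i => [//|i IH] /=; apply: EM.
have [f fP] := choice Ep.
have [i [j [ij _ e]]] : exists i j, [/\ (i < j)%N, (j < (size F).+1)%N & f i = f j].
  by apply: (@pigeonhole_In _ f F) => // i _; case: (fP i).
have [_ [k ek]] := fP i; have [_ [l el]] := fP j.
have e3 : gzpow a (Posz j - Posz i) = gzpow g (l - k).
  rewrite !gzpowD !gzpowN /= el ek e ginvM -!gmulA.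
  by rewrite gmulVK.
exists (l - k), (Posz j - Posz i); split => //; last by lia.
apply/eqP => lk0; rewrite lk0 in e3.
by apply: (@gzpow_neq1 a (Posz j - Posz i)) => //; lia.
Qed.

(* Descending induction along the lower central series: if [C_(i+1)] lies in
   the commensurator and [s] is in [C_i], then the commutator of [s] with [a]
   shows that [s^-1 a s] commensurates [g], hence has a power in <g>. *)
Lemma nilpotent_mod_sub_commens (G0 L : set G) (m : int) :
  is_subgroup G0 -> normal_in L G0 -> finite_pred L -> nilpotent_mod G0 L ->
  m != 0 -> G0 (gzpow g m) -> G0 `<=` commens g.
Proof.
move=> [G01 [G0M G0V]] [sL [LG0 Lnorm]] [nL [lL [_ [lLP _]]]] [n Cn] m0 G0a.
have [E1 [EM EV]] := commens_subgroup g.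
set a := gzpow g m in G0a.
have a_oo : infinite_order a by exact: gzpow_infinite_order.
have Ea : commens g a by exact: commens_gzpow.
have LE : L `<=` commens g.
  (* [L] is finite and normalised by [a], so two conjugates of [l] by powers of [a] coincide, and
     [l] commutes with a nontrivial power of [a]. *)
  move=> l Ll; pose f (i : nat) := gpow a i ** l ** ginv (gpow a i).
  have G0p i : G0 (gpow a i) by elim: i => [//|i IH] /=; apply: G0M.
  have [i [j [ij _ e]]] : exists i j, [/\ (i < j)%N, (j < (size lL).+1)%N & f i = f j].
    apply: (@pigeonhole_In _ f lL) => // i _; apply/lLP/Lnorm => //.
  pose k := Posz j - Posz i.
  have ek : l ** gzpow a k = gzpow a k ** l.
    have e' : l = gzpow a k ** l ** ginv (gzpow a k).
      rewrite /k gzpowD gzpowN /=.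
      apply: (@gmulIg (gpow a i)).
      have -> : gpow a j ** ginv (gpow a i) = ginv (gpow a i) ** gpow a j.
        have := gzpowD a (Posz j) (- Posz i); rewrite addrC gzpowD gzpowN /=.
        by move=> ->.
      rewrite ginvM ginvK -!gmulA gmulVK.
      have -> : gpow a i ** l = f i ** gpow a i by rewrite /f -!gmulA gmulVg gmulg1.
      by rewrite e /f -!gmulA.
    by rewrite {1}e' -!gmulA gmulVg gmulg1.
  apply: (@gzpow_conj_commens g l m) => //; exists (m * k), k.
  split; rewrite ?mulf_neq0 /k //; try by lia.
  by rewrite gzpow_conj -/a -/k ek -gmulA gmulgV gmulg1 gzpowM.
have sub i : lcs_mod G0 L i `<=` G0.
  elim: i => [//|i IH] /=; apply: gen_min; first by split.
  move=> x [/LG0 //|[b [c [Cb [Gc ->]]]]]; have Gb := IH _ Cb.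
  by rewrite /gcomm; apply: (G0M _ _ (G0M _ _ _ _) (G0M _ _ _ _)) => //; apply: G0V.
have key i : lcs_mod G0 L i.+1 `<=` commens g -> lcs_mod G0 L i `<=` commens g.
  move=> CE s Cs; rewrite -(ginvK s); apply: (EV).
  have Ec : commens g (gcomm s (ginv a)).
    apply: CE; apply: gen_sub; right; exists s, (ginv a); split => //.
    by split => //; apply: G0V.
  have Ecj : commens g (ginv s ** a ** ginv (ginv s)).
    have -> : ginv s ** a ** ginv (ginv s) = gcomm s (ginv a) ** a.
      by rewrite /gcomm !ginvK -!gmulA gmulVg gmulg1.
    exact: EM.
  apply: (@gzpow_conj_commens g (ginv s) m) => //.
  by apply: commens_power => //; apply: conj_infinite_order.
have : lcs_mod G0 L n `<=` commens g by exact: subset_trans Cn LE.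
elim: n {Cn} => [//|n IH] /key; exact: IH.
Qed.

End VirtuallyCyclicCommensurator.

End GroupTheory.

(** * Subadditive sequences *)

(** A bounded error cannot outweigh a difference of slopes. This is what makes growth rates
    insensitive to a change of base point. *)
Lemma archi_linear_le (R : realType) (a b c : R) :
  (forall n : nat, a *+ n <= b *+ n + c) -> a <= b.
Proof.
move=> h; rewrite leNgt; apply/negP => ba.
have ab : 0 < a - b by lra.
have := h (Num.truncn (`|c| / (a - b))).+1.
have : c < (a - b) *+ (Num.truncn (`|c| / (a - b))).+1.
  apply: le_lt_trans (ler_norm c) _.
  by rewrite -mulr_natr mulrC -ltr_pdivrMr // truncnS_gt.
by rewrite mulrnBl; lra.
Qed.

Section Fekete.
Variables (R : realType) (a : nat -> R).
Hypothesis a0 : a 0 = 0.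
Hypothesis a_ge0 : forall k, 0 <= a k.
Hypothesis a_sub : forall i j, a (i + j)%N <= a i + a j.

Let quot := [set a k.+1 / k.+1%:R | k in [set: nat]].
Let l0 := inf quot.

Let quot_lb : lbound quot 0.
Proof. by move=> _ [k _ <-]; rewrite divr_ge0 // ler0n. Qed.

Let quot_has_inf : has_inf quot.
Proof. by split; [exists (a 1 / 1%:R), 0%N | exists 0]. Qed.

Let l0_le k : k%:R * l0 <= a k.
Proof.
case: k => [|k]; first by rewrite a0 mul0r.
rewrite mulrC -ler_pdivlMr ?ltr0n //.
by apply: (ge_inf (quot_has_inf.2)); exists k.
Qed.

Let sub_mul q k : a (q * k)%N <= q%:R * a k.
Proof.
elim: q => [|q IH]; first by rewrite mul0n a0 mul0r.
rewrite mulSn; apply: le_trans (a_sub _ _) _.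
by rewrite -natr1 mulrDl mul1r addrC lerD2r.
Qed.

(** The index is divided by some [k.+1] whose quotient is within [e / 2] of the infimum. The
    remainder contributes at most [C], absorbed by the other [e / 2] for large indices. *)
Let l0_ev (e : R) : 0 < e -> exists N, forall k, (N <= k)%N -> a k <= k%:R * (l0 + e).
Proof.
move=> e0; have e2 : 0 < e / 2 by lra.
have [_ [k _ <-] ak] := inf_adherent e2 quot_has_inf.
have {}ak : a k.+1 <= (l0 + e / 2) * k.+1%:R.
  by rewrite -ler_pdivrMr ?ltr0n //; exact: ltW.
pose C := k.+1%:R * a 1.
exists (Num.truncn (C / (e / 2))).+1 => n nN.
have nC : C <= e / 2 * n%:R.
  rewrite mulrC -ler_pdivrMr //; apply: ltW.
  by apply: lt_le_trans (truncnS_gt _) _; rewrite ler_nat.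
have : a n <= (n %/ k.+1)%:R * a k.+1 + a (n %% k.+1)%N.
  rewrite {1}(divn_eq n k.+1); apply: le_trans (a_sub _ _) _.
  by rewrite lerD2r sub_mul.
have h1 : a (n %% k.+1)%N <= C.
  have := sub_mul (n %% k.+1)%N 1; rewrite muln1 => /le_trans; apply.
  by rewrite ler_wpM2r // ler_nat ltnW // ltn_mod.
have l0_ge0 : 0 <= l0 by apply: lb_le_inf quot_lb; case: quot_has_inf.
have h2 : (n %/ k.+1)%:R * a k.+1 <= n%:R * (l0 + e / 2).
  apply: (@le_trans _ _ ((n %/ k.+1)%:R * ((l0 + e / 2) * k.+1%:R))).
    by rewrite ler_wpM2l // ler0n.
  rewrite mulrCA mulrC ler_wpM2r //; first by lra.
  by rewrite -natrM ler_nat leq_trunc_div.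
move: nC h1 h2; set P := n%:R; set Q := C.
rewrite !mulrDr; move: (a _) (a _) ((n %/ _)%:R) => u v w; lra.
Qed.

(** Fekete's lemma. Convergence has to be proved, since [limn] is the limit only for a convergent
    sequence. *)
Lemma fekete_limn : limn (fun k => a k / k%:R) = l0.
Proof.
apply: (@cvg_lim) => //; apply/cvgrPdist_le => e e0.
have [N hN] := l0_ev e0.
(* [maxn N 1] discards the index 0, where the quotient divides by 0. *)
exists (maxn N 1) => // n /=; rewrite geq_max => /andP[Nn n0].
have n0' : 0 < n%:R :> R by rewrite ltr0n.
rewrite distrC ler_distl; apply/andP; split.
  rewrite ler_pdivlMr // mulrC; apply: le_trans (l0_le n).
  by rewrite ler_wpM2l ?ler0n //; lra.
by rewrite ler_pdivrMr // mulrC; exact: hN.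
Qed.

Lemma fekete_le k : k%:R * limn (fun k => a k / k%:R) <= a k.
Proof. by rewrite fekete_limn. Qed.

Lemma fekete_eventually (e : R) : 0 < e ->
  exists N, forall k, (N <= k)%N -> a k <= k%:R * (limn (fun k => a k / k%:R) + e).
Proof. by rewrite fekete_limn; exact: l0_ev. Qed.

End Fekete.

(** * Isometries of hyperbolic spaces *)

Section HyperbolicSpace.
Variables (R : realType) (X : Type) (d : X -> X -> R) (delta : R).
Hypothesis hyp : hyperbolic d delta.

Lemma dist_ge0 x y : 0 <= d x y. Proof. by case: hyp => [[+ _] _]; apply. Qed.
Lemma distxx x : d x x = 0. Proof. by case: hyp => [[_ [+ _]] _]; move/(_ x x) => [_ ->]. Qed.
Lemma dist_sym x y : d x y = d y x. Proof. by case: hyp => [[_ [_ [+ _]]] _]; apply. Qed.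
Lemma dist_tri y x z : d x z <= d x y + d y z.
Proof. by case: hyp => [[_ [_ [_ +]]] _]; apply. Qed.

Lemma geod_end c x y s : is_geod d c x y -> 0 <= s <= d x y ->
  d (c s) y = d x y - s.
Proof.
move=> [_ [c1 cd]] /andP[s0 s1]; rewrite -{1}c1 cd ?s0 ?s1 ?dist_ge0 ?lexx //.
by rewrite distrC ger0_norm // subr_ge0.
Qed.

Lemma geod_point x y s : 0 <= s <= d x y ->
  exists q, d x q = s /\ d q y = d x y - s.
Proof.
move=> /andP[s0 s1]; have [_ [_ [geo _]]] := hyp.
have [c gc] := geo x y; exists (c s); split; last first.
  by apply: geod_end => //; rewrite s0.
have [c0 [_ cd]] := gc; rewrite -{1}c0 cd ?lexx ?s0 ?s1 ?dist_ge0 //.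
by rewrite sub0r normrN ger0_norm.
Qed.

(** Up to the Gromov product of [x] and [y] at [w], both points lie on the branch of [w] in the
    tripod and have the same image there. *)
Lemma thin_corner w x y cwx cwy m : is_geod d cwx w x -> is_geod d cwy w y ->
  0 <= m -> m <= (d w x + d w y - d x y) / 2 -> d (cwx m) (cwy m) <= delta.
Proof.
move=> gx gy m0 m1; have [_ [_ [geo thin]]] := hyp.
have [cxy gxy] := geo x y.
have t1 := dist_tri y w x; have t2 := dist_tri x w y; have s := dist_sym x y.
apply: (thin _ _ _ _ _ _ gx gy gxy 0%N 1%N m m) => //=.
- by apply/andP; split; lra.
- by apply/andP; split; lra.
- by rewrite m1; split => //=; right.
Qed.

(* Gromov's inequality [(x|z)_w >= min ((x|y)_w, (y|z)_w) - delta], cleared of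
   Gromov products. *)
Lemma four_point x y z w :
  d x z + d y w <= d x y + d z w + 2 * delta \/
  d x z + d y w <= d x w + d y z + 2 * delta.
Proof.
have [_ [_ [geo _]]] := hyp.
have [cx gx] := geo w x; have [cy gy] := geo w y; have [cz gz] := geo w z.
(* The path from [x] to [z] through the points at distance [m] from [w] on the three geodesics; [m]
   will be the smaller of the two Gromov products. *)
have bound m : 0 <= m -> m <= (d w x + d w y - d x y) / 2 ->
    m <= (d w y + d w z - d y z) / 2 ->
    d x z <= d w x + d w z - 2 * m + 2 * delta.
  move=> m0 m1 m2.
  have mid := dist_tri (cy m) (cx m) (cz m).
  have hx := thin_corner gx gy m0 m1.
  have hz := thin_corner gy gz m0 m2.
  have := dist_tri y w x; have := dist_tri x w y; have := dist_sym x y.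
  have := dist_tri y w z; have := dist_tri z w y; have := dist_sym z y.
  have d0 := dist_ge0 w x; have d0' := dist_ge0 w z.
  move=> *.
  have ex : d (cx m) x = d w x - m by apply: geod_end => //; apply/andP; split; lra.
  have ez : d (cz m) z = d w z - m by apply: geod_end => //; apply/andP; split; lra.
  have := dist_sym x (cx m).
  have := dist_tri (cx m) x z; have := dist_tri (cz m) (cx m) z; lra.
have t1 := dist_tri w x y; have t2 := dist_tri w y z.
have := dist_sym w x; have := dist_sym w y; have := dist_sym w z.
move=> sz sy sx.
have [le|lt] := leP ((d w x + d w y - d x y) / 2) ((d w y + d w z - d y z) / 2).
  by left; have := bound _ _ (lexx _) le; lra.
by right; have := bound _ _ (ltW lt) (lexx _); lra.
Qed.

Section Action.
Variables (G : group) (act : G -> X -> X).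
Hypothesis iso : isometric_action d act.

Lemma act1 x : act (gone G) x = x. Proof. by case: iso. Qed.
Lemma actM g h x : act (gmul g h) x = act g (act h x).
Proof. by case: iso => [_ [+ _]]; apply. Qed.
Lemma act_isom g x y : d (act g x) (act g y) = d x y.
Proof. by case: iso => [_ [_ +]]; apply. Qed.

Lemma dist_act_inv g x y : d (act g x) y = d x (act (ginv g) y).
Proof. by rewrite -(act_isom (ginv g)) -actM gmulVg act1. Qed.

Lemma dist_act_ginv g x : d x (act (ginv g) x) = d x (act g x).
Proof. by rewrite -dist_act_inv dist_sym. Qed.

Lemma displ_mul g h x : d x (act (gmul g h) x) <= d x (act g x) + d x (act h x).
Proof. by rewrite actM -(act_isom g x (act h x)); exact: dist_tri. Qed.

Lemma dist_gzpow g (i j : int) x :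
  d (act (gzpow g i) x) (act (gzpow g j) x) = d x (act (gzpow g (j - i)) x).
Proof. by rewrite dist_act_inv -actM -gzpowN -gzpowD addrC. Qed.

Lemma dist_gzpowN g (i : int) x :
  d x (act (gzpow g (- i)) x) = d x (act (gzpow g i) x).
Proof. by rewrite gzpowN dist_act_ginv. Qed.

Lemma dist_gzpow_abs g (i : int) x :
  d x (act (gzpow g i) x) = d x (act (gpow g `|i|%N) x).
Proof.
rewrite -[gpow g _]/(gzpow g (Posz `|i|%N)).
have [->//|->] : Posz `|i|%N = i \/ Posz `|i|%N = - i by lia.
by rewrite dist_gzpowN.
Qed.

Lemma gpow_displ_sub g x i j :
  d x (act (gpow g (i + j)) x) <= d x (act (gpow g i) x) + d x (act (gpow g j) x).
Proof.
rewrite -[gpow g (i + j)]/(gzpow g (Posz (i + j)%N)) PoszD gzpowD.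
exact: displ_mul.
Qed.

Lemma gpow_displ_le g x n : d x (act (gpow g n) x) <= d x (act g x) *+ n.
Proof.
elim: n => [|n IH]; first by rewrite act1 distxx.
by rewrite mulrS; apply: le_trans (displ_mul _ _ _) _; rewrite lerD2l.
Qed.

(** * Asymptotic displacement and quasi-axes *)

Section Displacement.
Variables (p : X) (g : G).
Let l := displacement d act p g.

Lemma displacement_le_base k : k%:R * l <= d p (act (gpow g k) p).
Proof.
apply: fekete_le => [|n|i j]; [|exact: dist_ge0|exact: gpow_displ_sub].
by rewrite act1 distxx.
Qed.

Lemma displacement_eventually (e : R) : 0 < e ->
  exists N, forall k, (N <= k)%N -> d p (act (gpow g k) p) <= k%:R * (l + e).
Proof.
apply: fekete_eventually => [|n|i j]; [|exact: dist_ge0|exact: gpow_displ_sub].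
by rewrite act1 distxx.
Qed.

(** Passing from [p] to [x] costs [2 * d p x] for every power [k * n], which is negligible as [n]
    grows. *)
Lemma displacement_le x k : k%:R * l <= d x (act (gpow g k) x).
Proof.
apply: (@archi_linear_le _ _ _ (2 * d p x)) => n.
have h1 : (k%:R * l) *+ n <= d p (act (gpow g (k * n)) p).
  by rewrite -mulrnAl -mulrnA; exact: displacement_le_base.
have h2 := gpow_displ_le (gpow g k) x n.
have e : gpow (gpow g k) n = gpow g (k * n).
  exact: (gpow_gzpow g (Posz k) n).
rewrite e in h2.
have := dist_tri x p (act (gpow g (k * n)) p).
have := dist_tri (act (gpow g (k * n)) x) x (act (gpow g (k * n)) p).
rewrite act_isom (dist_sym x p); lra.
Qed.

Lemma displacement_ge0 : 0 <= l.
Proof.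
rewrite leNgt; apply/negP => l0.
have [M hM] : exists N, forall k, (N <= k)%N -> d p (act (gpow g k) p) <= k%:R * (l + - l / 2).
  by apply: displacement_eventually; lra.
have := hM M.+1 (leqnSn _); have := dist_ge0 p (act (gpow g M.+1) p).
have : M.+1%:R * (l + - l / 2) < 0 by rewrite pmulr_rlt0 ?ltr0n //; lra.
lra.
Qed.

(* Both endpoints of the segment move little relative to its length, so the
   midpoint is translated by at most the excess of [a] over [a m]. *)
Lemma midpoint_displ (m k : int) x (a := fun j : int => d p (act (gzpow g j) p)) :
  d p x = a m / 2 -> d x (act (gzpow g m) p) = a m / 2 ->
  let D := d x (act (gzpow g k) x) + a m - 4 * delta in
  [\/ D <= a k, D <= a (m + k) | D <= a (m - k)].
Proof.
move=> px xv D; pose v := act (gzpow g m) p.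
(* These are the translates of [v] and [p] by [g^-k]. They turn distances from [g^k x] into
   distances from [x], to which the four-point inequality applies a second time; each use costs
   [2 * delta]. *)
pose w1 := act (gzpow g (m - k)) p; pose w2 := act (gzpow g (- k)) p.
have e1 : d (act (gzpow g k) x) v = d x w1.
  by rewrite dist_act_inv -gzpowN -actM -gzpowD addrC.
have e2 : d p (act (gzpow g k) x) = d x w2.
  by rewrite dist_sym dist_act_inv -gzpowN.
have e3 : d w1 v = a k by rewrite dist_gzpow; congr (d _ (act (gzpow _ _) _)); lia.
have e4 : d w2 v = a (m + k) by rewrite dist_gzpow; congr (d _ (act (gzpow _ _) _)); lia.
have e5 : d p w2 = a k by rewrite /a -dist_gzpowN.
have e6 : d p w1 = a (m - k) by [].
have e7 : d p v = a m by [].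
have e8 : d x v = a m / 2 by [].
have sx := dist_sym x p.
have := four_point x p (act (gzpow g k) x) v.
have := four_point x p w1 v; have := four_point x p w2 v.
rewrite e1 e2 e3 e4 e5 e6 e7 e8 sx px.
have -> : d x (act (gzpow g k) x) = D - a m + 4 * delta by rewrite /D; lra.
move: (D) (a k) (a (m + k)) (a (m - k)) (a m) (d x w1) (d x w2) delta.
move=> {}D A1 A2 A3 A4 B1 B2 del.
move=> [h1|h1] [h2|h2] [h3|h3];
  first [by apply: Or31; lra | by apply: Or32; lra | by apply: Or33; lra].
Qed.

Lemma quasi_axis_point (e : R) : 0 < e ->
  exists x, forall k, d x (act (gpow g k) x) <= k%:R * (l + e) + 4 * delta.
Proof.
move=> e0; pose a (k : nat) := d p (act (gpow g k) p).
pose f k := a k - k%:R * (l + e).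
have le0 : 0 <= l + e by have := displacement_ge0; lra.
(* From [N] on, [f] is at most [0 = f 0], so the maximum over the indices up to [N] is global. *)
have [m fm] : exists m, forall k, f k <= f m.
  have [N hN] := displacement_eventually e0.
  have [i _ hi] := @arg_maxP _ _ _ (@ord0 N) predT (fun i : 'I_N.+1 => f i) isT.
  exists i => k; have [kN|Nk] := ltnP k N.+1; first exact: (hi (Ordinal kN)).
  apply: (@le_trans _ _ (f 0%N)); last exact: (hi ord0).
  by rewrite /f /a act1 distxx mul0r subr0 subr_le0; apply: hN; exact: ltnW.
have [|x [px xv]] := @geod_point p (act (gpow g m) p) (a m / 2).
  by have := dist_ge0 p (act (gpow g m) p); rewrite -/(a m) => ?; apply/andP; split; lra.
exists x => k.
have aE (j : int) : d p (act (gzpow g j) p) = a `|j|%N by exact: dist_gzpow_abs.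
have bnd (j : nat) : (j <= m + k)%N -> a j <= a m + k%:R * (l + e).
  move=> jmk; have := fm j; rewrite /f.
  have : j%:R * (l + e) <= (m%:R + k%:R) * (l + e).
    by rewrite ler_wpM2r // -natrD ler_nat.
  lra.
have := @midpoint_displ m k x px; rewrite xv /=.
have -> : d p (act (gpow g m) p) - a m / 2 = d p (act (gzpow g m) p) / 2.
  by change (a m - a m / 2 = a m / 2); lra.
move=> /(_ erefl); rewrite (aE (Posz m + Posz k)) (aE (Posz m - Posz k)).
have -> : d p (act (gzpow g m) p) = a m by [].
have -> : d p (act (gzpow g k) p) = a k by [].
case.
- by have := bnd k (leq_addl _ _); lra.
- have /bnd : (`|(Posz m + Posz k)%R|%N <= m + k)%N by lia.
  lra.
- have /bnd : (`|(Posz m - Posz k)%R|%N <= m + k)%N by lia.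
  lra.
Qed.

End Displacement.

(** A candidate that fails at one level fails at all higher ones, so it can be removed from the list
    without losing existence at any level. *)
Lemma finite_choice_all (T : Type) (s : seq T) (Q : T -> nat -> Prop) :
  (forall f m n, (m <= n)%N -> Q f n -> Q f m) ->
  (forall n, exists f, List.In f s /\ Q f n) ->
  exists f, forall n, Q f n.
Proof.
move=> Qanti; elim: s => [/(_ 0%N)[f []//]|f s IH h].
have [hf|/existsNP[n0 hf]] := pselect (forall n, Q f n); first by exists f.
apply: IH => n; have [f' [[ff'|fs] Qf']] := h (maxn n n0).
  by rewrite -ff' in Qf'; case: hf; apply: Qanti Qf'; rewrite leq_maxr.
by exists f'; split => //; apply: Qanti Qf'; rewrite leq_maxl.
Qed.

(** * Cocompact actions *)

Section Cocompact.
Variable C : R.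
Hypothesis C_ge0 : (0 : R) <= C.
Hypothesis delta_ge0 : (0 : R) <= delta.
Hypothesis cocompact : forall x y, exists g, d x (act g y) <= C.
Hypothesis act_proper : proper_action d act.

Lemma ball_list x r :
  exists s : seq G, forall g, d x (act g x) <= r -> List.In g s.
Proof.
have r0 : 0 < Num.max r 1 by rewrite lt_max ltr01 orbT.
have [n [s [_ [sP _]]]] := act_proper x r0.
by exists s => g gr; apply/sP; rewrite /= le_max gr.
Qed.

Section Axis.
Variables (p : X) (g : G).
Let l := displacement d act p g.

(* Letting [e] tend to [0] in [quasi_axis_point] keeps finitely many conjugates
   of [g] in play, one of which survives. *)
Lemma axis_point :
  exists x, forall k, d x (act (gpow g k) x) <= k%:R * l + (4 * delta + 2 * C).
Proof.
(* The radius is the bound for [k = 1] with the error [n.+1%:R^-1] replaced by 1, so one finite list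
   contains the candidates for all [n]. *)
have [s sP] := ball_list p (l + 1 + (4 * delta + 2 * C)).
pose Q (f : G) (n : nat) := exists2 h, f = gmul (gmul (ginv h) g) (ginv (ginv h)) &
  forall k, d p (act (gpow f k) p) <= k%:R * (l + n.+1%:R^-1) + (4 * delta + 2 * C).
have [f m n mn [h fh hk]|n|f fQ] := @finite_choice_all _ s Q.
- exists h => // k; apply: le_trans (hk k) _; rewrite lerD2r ler_wpM2l //.
  by rewrite lerD2l lef_pV2 ?posrE ?ltr0n // ler_nat ltnS.
- have n0 : 0 < n.+1%:R^-1 :> R by rewrite invr_gt0 ltr0n.
  have [x xP] := quasi_axis_point p g n0.
  have [h hx] := cocompact x p.
  pose f := gmul (gmul (ginv h) g) (ginv (ginv h)).
  have fk k : d p (act (gpow f k) p) <= k%:R * (l + n.+1%:R^-1) + (4 * delta + 2 * C).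
    have -> : gpow f k = gmul (gmul (ginv h) (gpow g k)) (ginv (ginv h)).
      exact: (gzpow_conj g (ginv h) k).
    rewrite ginvK !actM -dist_act_inv.
    have := dist_tri x (act h p) (act (gpow g k) (act h p)).
    have := dist_tri (act (gpow g k) x) x (act (gpow g k) (act h p)).
    rewrite act_isom (dist_sym (act h p) x); have := xP k; rewrite -/l.
    by move: (k%:R * _) => E; lra.
  exists f; split; last by exists h.
  apply: sP; have := fk 1%N; rewrite /= gmulg1 mul1r.
  have : n.+1%:R^-1 <= 1 :> R by rewrite invf_le1 ?ltr0n // ler1n.
  by move: (_^-1) => E; lra.
have [h fh _] := fQ 0%N.
exists (act h p) => k.
have -> : d (act h p) (act (gpow g k) (act h p)) = d p (act (gpow f k) p).
  have -> : gpow f k = gmul (gmul (ginv h) (gpow g k)) (ginv (ginv h)).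
    by rewrite fh; exact: (gzpow_conj g (ginv h) k).
  by rewrite ginvK !actM -dist_act_inv.
rewrite -subr_le0; apply: (@archi_linear_le _ _ _ k%:R) => n.
have [h' _ /(_ k)] := fQ n.
set A := d p _; rewrite mul0rn add0r => An.
have n0 : 0 < n.+1%:R :> R by rewrite ltr0n.
have e : A - (k%:R * l + (4 * delta + 2 * C)) <= k%:R / n.+1%:R.
  by move: An; rewrite mulrDr; move: (k%:R / _) => E; lra.
have [B0|B0] := leP (A - (k%:R * l + (4 * delta + 2 * C))) 0.
  by apply: (@le_trans _ _ 0); rewrite ?mulrn_wle0.
apply: (@le_trans _ _ ((A - (k%:R * l + (4 * delta + 2 * C))) *+ n.+1)).
  by rewrite (mulrS _ n) lerDr ltW.
by rewrite -(mulr_natr _ n.+1) -ler_pdivlMr.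
Qed.

Hypothesis g_oo : infinite_order g.

Lemma displacement_gt0 : 0 < l.
Proof.
rewrite lt_neqAle displacement_ge0 andbT; apply/eqP => l0.
have [x xP] := axis_point.
have [s sP] := ball_list x (4 * delta + 2 * C).
have [i [j [ij _ e]]] : exists i j, [/\ (i < j)%N, (j < (size s).+1)%N & gpow g i = gpow g j].
  apply: (@pigeonhole_In _ _ s) => // i _; apply: sP.
  by have := xP i; rewrite -l0 mulr0 add0r.
apply: (@gzpow_neq1 _ g (Posz j - Posz i)) => //; first by lia.
by rewrite gzpowD gzpowN /= -e gmulgV.
Qed.

Section CommensuratorNearAxis.
Variables (x : X) (B : R).
Hypothesis B_ge0 : (0 : R) <= B.
Hypothesis xP : forall k, d x (act (gpow g k) x) <= k%:R * l + B.

Let A k := d x (act (gpow g k) x).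

Let AE (j : int) : d x (act (gzpow g j) x) = A `|j|%N.
Proof. exact: dist_gzpow_abs. Qed.

Let A_ge k : k%:R * l <= A k. Proof. exact: displacement_le. Qed.

Lemma commens_near_axis s : commens g s ->
  exists k : int, d (act s x) (act (gzpow g k) x) <= 2 * B + 4 * delta + A 1.
Proof.
move=> [p0 [q0 [p0_neq0 q0_neq0 e0]]].
have [P [q [q_gt0 e]]] : exists (P : int) (q : nat), (0 < q)%N /\
    gmul (gmul s (gzpow g P)) (ginv s) = gzpow g q.
  case: q0 q0_neq0 e0 => [q|q] q_neq0 e; first by exists p0, q; split => //; lia.
  exists (- p0), q.+1; split => //.
  have -> : Posz q.+1 = - Negz q by lia.
  by rewrite !gzpowN -e !ginvM ginvK gmulA.
pose y := act s x; pose r := d x y.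
have yq n : d y (act (gpow g (q * n)) y) = A (`|P| * n)%N.
  have -> : gpow g (q * n) = gmul (gmul s (gzpow g (P * n%:Z))) (ginv s).
    by rewrite gzpowM -gzpow_conj e -gzpowM -PoszM.
  rewrite !actM -(actM (ginv s)) gmulVg act1 act_isom AE.
  by congr A; rewrite abszM absz_nat.
have r_ge0 : 0 <= r by exact: dist_ge0.
have l_gt0 := displacement_gt0.
(* Comparison of translation lengths: [g^q] is conjugate to [g^P], which translates by [|P| * l] up
   to a bounded error after iteration. *)
have Pq : (`|P| <= q)%N.
  rewrite -(ler_nat R) -(ler_pM2r l_gt0).
  apply: (@archi_linear_le _ _ _ (2 * r + B)) => n.
  rewrite -!mulrnAl -!mulrnA.
  apply: le_trans (A_ge _) _; rewrite -yq.
  have := xP (q * n).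
  have := dist_tri x y (act (gpow g (q * n)) y).
  have := dist_tri (act (gpow g (q * n)) x) x (act (gpow g (q * n)) y).
  rewrite act_isom -/r (dist_sym y x) -/r; lra.
(* [K] is a multiple of [q], so that [yq] applies, and is so large that the term [2 * r] in the
   four-point inequality for [between] is at most [2 * (K%:R * l)]. *)
pose n := (Num.truncn (r / l)).+1; pose K := (q * n)%N.
have Kl : r <= K%:R * l.
  rewrite -ler_pdivrMr //; apply: ltW.
  apply: lt_le_trans (truncnS_gt (r / l)) _.
  by rewrite ler_nat /K leq_pmull.
have yK : d y (act (gpow g K) y) <= K%:R * l + B.
  rewrite yq; apply: le_trans (xP _) _; rewrite lerD2r ler_wpM2r ?(ltW l_gt0) //.
  by rewrite ler_nat leq_mul2r Pq orbT.
pose xm := act (gzpow g (- K%:Z)) x; pose xp := act (gpow g K) x.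
have between : d xm y + d y xp <= 2 * (K%:R * l) + 2 * B + 2 * delta.
  have -> : d xm y = d x (act (gpow g K) y).
    by rewrite dist_act_inv -gzpowN opprK.
  have := four_point x y (act (gpow g K) y) xp.
  rewrite act_isom (dist_sym y x) -/r -/xp.
  have := xP K; rewrite -/xp; move: yK Kl B_ge0.
  by move=> ? ? ? ? [?|?]; lra.
have mz (i : nat) : d xm (act (gzpow g (i%:Z - K%:Z)) x) = A i.
  by rewrite dist_gzpow AE; congr A; lia.
have zp (i : nat) : (i <= 2 * K)%N ->
    d (act (gzpow g (i%:Z - K%:Z)) x) xp = A (2 * K - i).
  move=> iK; rewrite -[xp]/(act (gzpow g K%:Z) x) dist_gzpow AE; congr A; lia.
have mp : d xm xp = A (2 * K).
  by rewrite -[xp]/(act (gzpow g K%:Z) x) dist_gzpow AE; congr A; lia.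
have A2K : 2 * (K%:R * l) <= A (2 * K).
  by have := A_ge (2 * K); rewrite natrM mulrA.
have A1_ge0 : 0 <= A 1 by exact: dist_ge0.
have [big|small] := leP (d xm y) (A (2 * K)); last first.
  by exists K; rewrite -/y -[act (gzpow g K) x]/xp; move: between small A2K delta_ge0; lra.
(* Discrete intermediate value: [A] increases by at most [A 1] per step. The resulting [z] and [y]
   are about equally far from [xm] and both almost between [xm] and [xp], hence close. *)
have [i [iK Ai Ai1]] : exists i, [/\ (i <= 2 * K)%N, A i <= d xm y & d xm y <= A i + A 1].
  have ex : exists j, d xm y <= A j by exists (2 * K)%N.
  case: (ex_minnP ex) => -[|j] jA jmin.
    exists 0%N; split => //; first by rewrite /A act1 distxx; exact: dist_ge0.
    by apply: le_trans jA _; rewrite lerDl.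
  exists j; split.
  - by apply: ltnW; exact: jmin.
  - by rewrite leNgt; apply/negP => /ltW /jmin; rewrite ltnn.
  - by apply: le_trans jA _; rewrite -addn1; exact: gpow_displ_sub.
exists (i%:Z - K%:Z); rewrite -/y; set z := act _ x.
have := four_point y xm z xp.
rewrite mz zp // mp (dist_sym y xm).
have := xP (2 * K - i); have := xP i; rewrite -/(A _) -/(A _).
rewrite natrB // natrM.
have -> : (2 * K%:R - i%:R) * l = 2 * (K%:R * l) - i%:R * l by ring.
move: between big A2K Ai Ai1 A1_ge0 delta_ge0 B_ge0; rewrite -/(A _).
move: (A (2 * K)) (A (2 * K - i)) (A i) (A 1) (K%:R * l) (i%:R * l) (d xm y) (d y xp) (d y z).
by move=> a1 a2 a3 a4 a5 a6 a7 a8 a9 h1 h2 h3 h4 h5 h6 h7 h8 h9 h10 [h|h]; lra.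
Qed.

End CommensuratorNearAxis.

Lemma commens_finite_cover : exists F : seq G, forall s, commens g s ->
  exists (k : int) f, List.In f F /\ s = gmul (gzpow g k) f.
Proof.
have [x xP] := axis_point.
have B0 : (0 : R) <= 4 * delta + 2 * C by move: C_ge0 delta_ge0; lra.
have [F FP] := ball_list x (2 * (4 * delta + 2 * C) + 4 * delta + d x (act (gpow g 1) x)).
exists F => s /(commens_near_axis B0 xP)[k kP].
exists k, (gmul (ginv (gzpow g k)) s); split; last by rewrite gmulVK.
by apply: FP; rewrite actM -dist_act_inv dist_sym.
Qed.

End Axis.

(** A geodesic from [x] to its image is cut into pieces of length at most [C], each division point
    being [C]-close to the orbit; consecutive orbit points are then at distance at most [3 * C]. *)
Lemma subgroup_full x (K : set G) : is_subgroup K -> (0 : R) < C ->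
  (forall s, d x (act s x) <= 3 * C -> K s) -> forall s, K s.
Proof.
move=> [K1 [KM KV]] C_gt0 Kgen.
have main n : forall q u, d x q <= n%:R * C -> d q (act u x) <= C -> K u.
  elim: n => [|n IH] q u.
    move=> xq qu; apply: Kgen; rewrite mul0r in xq.
    have {}xq : d x q <= 0 := xq.
    by have := dist_tri q x (act u x); move: C_gt0; lra.
  rewrite -natr1 mulrDl mul1r => xq qu.
  pose t := Num.min (d x q) (n%:R * C).
  have [|q' [xq' q'q]] := @geod_point x q t.
    by rewrite ge_min lexx le_min dist_ge0 mulr_ge0 ?ler0n.
  have q'qC : d q' q <= C.
    by rewrite q'q /t; case: (leP (d x q)) => _; [rewrite subrr|rewrite lerBlDl].
  have [u' u'P] := cocompact q' x.
  have Ku' : K u' by apply: IH u'P; rewrite xq' ge_min lexx orbT.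
  rewrite -(gmulVK u' u); apply: KM => //; apply: Kgen.
  rewrite actM -dist_act_inv.
  have := dist_tri q' (act u' x) (act u x); have := dist_tri q q' (act u x).
  by rewrite (dist_sym _ q'); lra.
move=> s; apply: (main (Num.truncn (d x (act s x) / C)).+1 (act s x)).
  by rewrite -ler_pdivrMr // ltW // truncnS_gt.
by rewrite distxx.
Qed.

Lemma exists_not_commens x g : (0 : R) < C -> infinite_order g -> ~ virtually_cyclic G ->
  exists2 s, d x (act s x) <= 3 * C & ~ commens g s.
Proof.
move=> C_gt0 g_oo nvc; apply: contrapT => nex; apply: nvc.
have full := @subgroup_full x _ (commens_subgroup g) C_gt0.
have [F FP] := commens_finite_cover x g_oo.
(* Inversion turns right cosets of the cyclic subgroup into the left cosets required by
   [virtually_cyclic]. *)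
exists g, [seq ginv f | f <- F] => h.
have [|k [f [Ff e]]] := FP (ginv h).
  apply: full => s sx; apply: contrapT => ns; by apply: nex; exists s.
exists (ginv f), (- k); split; first exact: List.in_map.
by rewrite gzpowN -ginvM -e ginvK.
Qed.

(** * Growth of orbits *)

Section Doubling.
Variable x : X.
Local Notation T := {classic G}.

Lemma displ_ball_enum (r : R) : exists s : seq T,
  uniq s /\ forall g : T, (g \in s) = (d x (act g x) <= r).
Proof.
have [s sP] := ball_list x r.
exists (undup [seq g : T <- s | d x (act g x) <= r]); split => [|g].
  exact: undup_uniq.
rewrite mem_undup mem_filter andb_idr // => /sP ?.
exact/(@In_mem T).
Qed.

Definition displ_ball (r : R) : seq T := projT1 (cid (displ_ball_enum r)).

Lemma displ_ball_uniq r : uniq (displ_ball r).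
Proof. by rewrite /displ_ball; case: cid => s []. Qed.

Lemma mem_displ_ball r (g : T) : (g \in displ_ball r) = (d x (act g x) <= r).
Proof. by rewrite /displ_ball; case: cid => s []. Qed.

Local Notation N r := (size (displ_ball r)).

Lemma card_displ_ball (r : R) : card_is [set g | d x (act g x) <= r] (N r).
Proof.
apply/card_isP; exists (displ_ball r); split => //; first exact: displ_ball_uniq.
by move=> g; rewrite mem_displ_ball.
Qed.

Lemma displ_ball_le (r r' : R) : r <= r' -> (N r <= N r')%N.
Proof.
move=> rr'; apply: uniq_leq_size (displ_ball_uniq r) _ => g.
by rewrite !mem_displ_ball => /le_trans; apply.
Qed.

Lemma displ_ball_gt0 (r : R) : (0 : R) <= r -> (0 < N r)%N.
Proof.
move=> r0; rewrite lt0n size_eq0; apply/eqP => e.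
by have := mem_displ_ball r (gone G); rewrite e act1 distxx r0.
Qed.

Lemma translated_displ_ball_le u (s : seq T) (r : R) : uniq s ->
  {in s, forall g : T, d (act u x) (act g x) <= r} -> (size s <= N r)%N.
Proof.
move=> us sr; rewrite -(size_map (fun g : T => gmul (ginv u) g : T)).
apply: uniq_leq_size.
  by rewrite map_inj_uniq // => g h; exact: gmulIg.
by move=> _ /mapP[g gs ->]; rewrite mem_displ_ball actM -dist_act_inv; exact: sr.
Qed.

Section Growth.
Variables rho t : R.
Hypothesis t_ge0 : (0 : R) <= t.
Let c := t + 2 * delta + C.

(* [s] continues the displacement of [g] up to a bounded loss: the Gromov product
   of [g^-1 x] and [s x] at [x] is at most [c]. *)
Definition outward (g s : T) :=
  (rho - t < d x (act s x)) &&
  (d x (act g x) + d x (act s x) - d x (act (gmul g s) x) <= 2 * c).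

(** An element that is not outward either has displacement at most [rho - t] or lies in the shadow
    of [w]. In the second case its orbit point is within [rho - c + 2 * delta] of the point [q] at
    distance [c] on the way to [w]; [c] is chosen so that, after moving [q] to the orbit, this
    becomes [rho - t]. *)
Lemma outward_count g :
  (N rho <= count (outward g) (displ_ball rho) + 2 * N (rho - t))%N.
Proof.
pose w := act (ginv g) x.
have wx : d w x = d x (act g x) by rewrite dist_sym dist_act_ginv.
have ws s : d w (act s x) = d x (act (gmul g s) x).
  by rewrite dist_act_inv ginvK -actM.
pose near (s : T) := d x (act s x) <= rho - t.
pose shadow (s : T) := 2 * c < d w x + d x (act s x) - d w (act s x).
have near_le : (count near (displ_ball rho) <= N (rho - t))%N.
  rewrite -size_filter; apply: uniq_leq_size; first by rewrite filter_uniq ?displ_ball_uniq.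
  by move=> s; rewrite mem_filter !mem_displ_ball => /andP[].
have shadow_le : (count shadow (displ_ball rho) <= N (rho - t))%N.
  have [cw|wc] := leP c (d x w); last first.
    rewrite (_ : count _ _ = 0%N) //; apply/eqP; rewrite -leqn0 leqNgt -has_count.
    apply/hasPn => s _; rewrite /shadow -leNgt.
    have := dist_tri w x (act s x); rewrite (dist_sym w x); move: wc; lra.
  have c_ge0 : (0 : R) <= c by rewrite /c; move: t_ge0 delta_ge0 C_ge0; lra.
  have [|q [xq qw]] := @geod_point x w c; first by rewrite c_ge0.
  have [u uP] := cocompact q x.
  rewrite -size_filter; apply: (@translated_displ_ball_le u).
    by rewrite filter_uniq ?displ_ball_uniq.
  move=> s; rewrite mem_filter mem_displ_ball => /andP[]; rewrite /shadow => sh srho.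
  have := dist_tri q (act u x) (act s x); rewrite (dist_sym (act u x) q).
  have := four_point q w (act s x) x.
  move: sh srho uP; rewrite qw (dist_sym q x) xq (dist_sym (act s x) x) (dist_sym w x) /c.
  by move=> ? ? ? [?|?]; lra.
rewrite -(count_predC (outward g)) leq_add2l mul2n -addnn.
apply: leq_trans (leq_add near_le shadow_le); rewrite -count_predUI.
apply: leq_trans (leq_addr _ _); apply: sub_count => s /=.
rewrite /outward negb_and -!leNgt -ltNge /near /shadow wx ws.
by case/orP => ->; rewrite ?orbT.
Qed.

(** The points [g x] in question are at distance between [rho - t] and [rho] from [h x] and almost
    between [x] and [h x], so the four-point inequality places them within [t + 2 * c + 2 * delta]
    of each other. *)
Lemma outward_fiber h (r' : R) : 3 * t + 2 * C + 6 * delta <= r' -> forall W : seq T, uniq W ->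
  (count (fun g : T => (gmul (ginv g) h : T) \in
     [seq s <- displ_ball rho | outward g s]) W <= N r')%N.
Proof.
move=> r'P W uW; rewrite -size_filter; set V := (X in (size X <= _)%N).
have inV g : g \in V -> [/\ rho - t < d (act g x) (act h x),
    d (act g x) (act h x) <= rho &
    d x (act g x) + d (act g x) (act h x) - d x (act h x) <= 2 * c].
  rewrite mem_filter mem_filter mem_displ_ball /outward gmulVK actM -dist_act_inv.
  by move=> /andP[/andP[/andP[-> ->] ->]].
have uV : uniq V by rewrite filter_uniq.
case: V uV inV => [//|g0 V] uV inV.
apply: (@translated_displ_ball_le g0) => // g gV.
have [a1 a2 a3] := inV g0 (mem_head _ _).
have [b1 b2 b3] := inV g gV.
have := four_point (act g0 x) x (act g x) (act h x).
move: a1 a2 a3 b1 b2 b3 r'P; rewrite (dist_sym (act g0 x) x) /c.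
by move=> ? ? ? ? ? ? ? [?|?]; lra.
Qed.

(** Double counting of the factorisations [h = g s] with [g] in the ball of radius [r1] and [s]
    outward for [g]. *)
Lemma displ_ball_growth (r1 r' : R) : 3 * t + 2 * C + 6 * delta <= r' ->
  ((N rho - 2 * N (rho - t)) * N r1 <= N r' * N (r1 + rho))%N.
Proof.
move=> r'P.
pose rel (g h : T) := (gmul (ginv g) h : T) \in [seq s <- displ_ball rho | outward g s].
apply: (@double_count _ _ _ rel) => [g|h _]; last first.
  by apply: outward_fiber => //; exact: displ_ball_uniq.
rewrite mem_displ_ball => gr1; rewrite leq_subLR addnC.
apply: leq_trans (outward_count g) _; rewrite leq_add2r -!size_filter.
rewrite -(size_map (fun s : T => gmul g s : T)); apply: uniq_leq_size.
  by rewrite map_inj_uniq ?filter_uniq ?displ_ball_uniq // => a b; exact: gmulIg.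
move=> _ /mapP[s sP ->]; rewrite mem_filter /rel gmulKV sP /= mem_displ_ball.
apply: le_trans (displ_mul _ _ _) _; apply: lerD => //.
by move: sP; rewrite mem_filter mem_displ_ball => /andP[].
Qed.

End Growth.

(* Five steps of length [t] lead from [5t] to [10t]; the last one along which
   the count more than triples is the scale at which growth propagates. *)
Lemma displ_ball_exp_growth (t E : R) : (0 : R) <= t -> C + 3 * delta <= t -> (1 : R) <= E ->
  3 ^+ 5 * E * (N (5 * t))%:R < (N (10 * t))%:R ->
  forall n, E ^+ n <= (N (n%:R * (10 * t)))%:R.
Proof.
move=> t0 tP E1 big.
have [rho [rho0 rho10 step E3]] : exists rho, [/\ (0 : R) <= rho, rho <= 10 * t,
    3 * (N (rho - t))%:R < (N rho)%:R :> R & 3 * E * (N (5 * t))%:R < (N rho)%:R].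
  have n0 : (0 : R) <= (N (5 * t))%:R by [].
  have e10 : 10 * t - t = 9 * t by ring.
  have e9 : 9 * t - t = 8 * t by ring.
  have e8 : 8 * t - t = 7 * t by ring.
  have e7 : 7 * t - t = 6 * t by ring.
  have e6 : 6 * t - t = 5 * t by ring.
  have En : (N (5 * t))%:R <= E * (N (5 * t))%:R by rewrite ler_peMl.
  have [h10|h10] := ltP (3 * (N (9 * t))%:R) ((N (10 * t))%:R : R).
    exists (10 * t); rewrite e10; split => //; [by move: t0; lra|].
    by move: big n0 En; rewrite -!mulrA; lra.
  have [h9|h9] := ltP (3 * (N (8 * t))%:R) ((N (9 * t))%:R : R).
    exists (9 * t); rewrite e9; split => //; [by move: t0; lra|by move: t0; lra|].
    by move: big n0 En h10; rewrite -!mulrA; lra.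
  have [h8|h8] := ltP (3 * (N (7 * t))%:R) ((N (8 * t))%:R : R).
    exists (8 * t); rewrite e8; split => //; [by move: t0; lra|by move: t0; lra|].
    by move: big n0 En h10 h9; rewrite -!mulrA; lra.
  have [h7|h7] := ltP (3 * (N (6 * t))%:R) ((N (7 * t))%:R : R).
    exists (7 * t); rewrite e7; split => //; [by move: t0; lra|by move: t0; lra|].
    by move: big n0 En h10 h9 h8; rewrite -!mulrA; lra.
  (* Four steps that at most triple the count use up [3 ^+ 4], so the remaining one gains more than
     [3 * E]. *)
  exists (6 * t); rewrite e6; split => //; [by move: t0; lra|by move: t0; lra| |].
    by move: big n0 En h10 h9 h8 h7; rewrite -!mulrA; lra.
  by move: big n0 En h10 h9 h8 h7; rewrite -!mulrA; lra.
have N5 : (0 : R) < (N (5 * t))%:R by rewrite ltr0n displ_ball_gt0 // mulr_ge0.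
have grow n : E * (N (n%:R * rho))%:R <= (N (n.+1%:R * rho))%:R.
  have -> : n.+1%:R * rho = n%:R * rho + rho by rewrite -natr1 mulrDl mul1r.
  have fiber : 3 * t + 2 * C + 6 * delta <= 5 * t by move: tP; lra.
  have := @displ_ball_growth rho t t0 (n%:R * rho) (5 * t) fiber.
  rewrite -(ler_nat R) !natrM natrB; last first.
    by rewrite -(ler_nat R) natrM; apply: le_trans (ltW step); rewrite ler_wpM2r // ler_nat.
  rewrite natrM => g.
  (* By [step], subtracting twice the smaller ball leaves a third of [N rho]. *)
  have o : E * (N (5 * t))%:R <= (N rho)%:R - 2 * (N (rho - t))%:R.
    by move: step E3; rewrite -!mulrA; lra.
  rewrite -(ler_pM2l N5); apply: le_trans g.
  by rewrite mulrA [_ * E]mulrC ler_wpM2r.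
move=> n; apply: (@le_trans _ _ (N (n%:R * rho))%:R); last first.
  by rewrite ler_nat; apply: displ_ball_le; rewrite ler_wpM2l.
elim: n => [|n IH]; first by rewrite expr0 ler1n displ_ball_gt0 // mul0r.
by apply: le_trans (grow n); rewrite exprS ler_wpM2l //; move: E1; lra.
Qed.

Lemma entropy_growth (H kap rho : R) : (0 : R) < rho -> (0 : R) <= kap ->
  (entropy d act x <= H%:E)%E ->
  (forall n, expR kap ^+ n <= (N (n%:R * rho))%:R) -> kap <= H * rho.
Proof.
move=> rho0 kap0 entH gr; rewrite leNgt; apply/negP => lt.
have lt' : H < kap / rho by rewrite ltr_pdivlMr.
pose H' := (H + kap / rho) / 2.
have HH' : H < H' by rewrite /H'; lra.
have H'k : 0 < kap / rho - H' by rewrite /H'; lra.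
suff : (H'%:E <= H%:E)%E by rewrite lee_fin; move: HH'; lra.
apply: le_trans entH; rewrite /entropy limf_einfE.
(* Beyond [r0] the gap between the rates [kap / rho] and [H'] makes up for the loss [2 * kap] caused
   by rounding [r] down to a multiple of [rho]. *)
pose r0 := Num.max rho (2 * kap / (kap / rho - H')).
pose V := [set r : R | r0 <= r].
apply: (@le_trans _ _ (ereal_inf
    [set (ln ((ncard [set g : G | d x (act g x) < r])%:R) / r)%:E | r in V])).
  apply: le_ereal_inf_tmp => _ [r /= r0r <-]; rewrite lee_fin.
  move: r0r; rewrite /V /= /r0 ge_max => /andP[rhor]; rewrite ler_pdivrMr // => kr.
  have r_gt0 : 0 < r by exact: lt_le_trans rhor.
  rewrite ler_pdivlMr //.
  (* The entropy counts strict inequalities, so [n%:R * rho < r] must be strict; hence [n.+2]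
     instead of [n.+1]. *)
  have [n [n1 n2]] : exists n : nat, n%:R * rho < r /\ r < n.+2%:R * rho.
    have := truncn_itv (divr_ge0 (ltW r_gt0) (ltW rho0)).
    set m := Num.truncn _ => /andP[m1 m2].
    move: m1 m2; rewrite ler_pdivlMr // ltr_pdivrMr //.
    case: m => [|m] m1 m2.
      exists 0%N; rewrite mul0r; split => //.
      by apply: lt_trans m2 _; rewrite ltr_pM2r // ltr_nat.
    exists m; split => //; apply: lt_le_trans m1.
    by rewrite ltr_pM2r // ltr_nat.
  have Nn : (N (n%:R * rho) <= ncard [set g : G | (d x (act g x) < r)%R])%N.
    have -> : ncard [set g : G | (d x (act g x) < r)%R] =
        size [seq g : T <- displ_ball r | d x (act g x) < r].
      apply: ncardE; apply/card_isP; exists [seq g : T <- displ_ball r | d x (act g x) < r].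
      split => //; first by rewrite filter_uniq ?displ_ball_uniq.
      move=> g; rewrite (@mem_filter T) mem_displ_ball /=; split => [gr'|/andP[]//].
      by rewrite gr' ltW.
    apply: uniq_leq_size (displ_ball_uniq _) _ => g.
    rewrite (@mem_filter T) !mem_displ_ball => gn.
    by have glt := le_lt_trans gn n1; rewrite glt ltW.
  apply: (@le_trans _ _ (n%:R * kap)).
    have : kap / rho * r < (n.+2)%:R * kap \/ kap = 0.
      have [k0|k0] := ltP 0 kap; last by right; apply/le_anti; rewrite k0.
      by left; rewrite mulrAC ltr_pdivrMr // [ltRHS]mulrAC [ltRHS]mulrC ltr_pM2l.
    rewrite -!natr1; move: kr; rewrite mulrBr.
    have -> : r * (kap / rho) = kap / rho * r by rewrite mulrC.
    rewrite mulrC [H' * r]mulrC.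
    move=> h1 [h2|h2]; last first.
      by move: h1; rewrite h2 !mul0r !mulr0; lra.
    move: h1 h2; rewrite !mulrDl !mul1r.
    by move: (kap / rho * r) (r * H') (n%:R * kap) => *; lra.
  rewrite -(expRK (n%:R * kap)) ler_ln ?posrE ?expR_gt0 //.
    by rewrite expRM_natl; apply: le_trans (gr n) _; rewrite ler_nat.
  rewrite ltr0n; apply: leq_trans Nn; apply: displ_ball_gt0.
  by rewrite mulr_ge0 // ltW.
apply: ereal_sup_ubound; exists V => //.
exists r0; split; first by rewrite num_real.
by move=> r /= /ltW.
Qed.

Lemma displ_ball_doubling (H t kap : R) :
  (0 : R) < t -> C + 3 * delta <= t -> (0 : R) <= kap ->
  (entropy d act x <= H%:E)%E -> H * (10 * t) < kap ->
  (N (10 * t))%:R <= 3 ^+ 5 * expR kap * (N (5 * t))%:R.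
Proof.
move=> t0 tP kap0 entH lt; rewrite leNgt; apply/negP => big.
have E1 : 1 <= expR kap by rewrite -expR0 ler_expR.
have := displ_ball_exp_growth (ltW t0) tP E1 big.
move/(entropy_growth _ kap0 entH) => h.
by move: lt; rewrite ltNge h // mulr_gt0.
Qed.

End Doubling.

End Cocompact.
End Action.
End HyperbolicSpace.

(** * From the quotient diameter to the displacement bound *)

Lemma quot_diam_cocompact (R : realType) (X : Type) (d : X -> X -> R)
    (G : group) (act : G -> X -> X) (D : R) :
  (0 : R) < D -> (quot_diam d act <= D%:E)%E ->
  forall x y, exists g, d x (act g y) <= 2 * D.
Proof.
move=> D0 diam x y.
have : (qdist d act x y < (2 * D)%:E)%E.
  (* The infimum over the orbit need not be attained, whence a constant larger than [D]. *)
  apply: (@le_lt_trans _ _ D%:E); last by rewrite lte_fin; move: D0; lra.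
  by apply: le_trans diam; apply: ereal_sup_ubound; exists x => //; exists y.
move=> /ereal_inf_lt[_ [g _ <-]]; rewrite lte_fin => /ltW ?.
by exists g.
Qed.

Lemma leq_double_half_succ n : (2 * n.+1./2 <= n.+1)%N.
Proof. lia. Qed.

Lemma dist_half_succ_le n i : (i <= n)%N ->
  (`|(Posz i - Posz n.+1./2)%R| <= n.+1./2)%N.
Proof. lia. Qed.

Theorem mainTheorem4 (R : realType) (nu : R -> nat) (delta H D : R)
  (X : Type) (d : X -> X -> R) (Gam : group) (act : Gam -> X -> X) :
  BGT_function nu ->
  0 < delta -> 0 < H -> 0 < D ->
  hyperbolic d delta ->
  ~ virtually_cyclic Gam ->
  isometric_action d act -> proper_action d act ->
  (quot_diam d act <= D%:E)%E ->
  (forall p : X, (entropy d act p <= H%:E)%E) ->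
  forall g : Gam, g <> gone Gam -> infinite_order g ->
  forall p : X,
    displacement d act p g >
      (2 * (5 * D + delta)) /
      ((nu (3 ^+ 5 * expR (73 * H * (D + 4 * delta))))%:R + 2).
Proof.
move=> [_ [_ bgt]] delta0 H0 D0 hyp nvc iso prop diam ent g _ g_oo p.
have cocompact := quot_diam_cocompact D0 diam.
have C0 : (0 : R) < 2 * D by rewrite mulr_gt0.
have dl0 := ltW delta0.
set K := 3 ^+ 5 * _; set n := nu K; set l := displacement d act p g.
rewrite ltNge; apply/negP => small.
have [x xP] := axis_point hyp iso cocompact prop p g.
have [s sD sNE] := exists_not_commens hyp iso (ltW C0) dl0 cocompact prop x C0 g_oo nvc.
have [F FP] := commens_finite_cover hyp iso (ltW C0) dl0 cocompact prop p g_oo.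
(* [10 * t] is [60 * (D + 4 * delta)], so the exponent with 73 exceeds [H * (10 * t)], as doubling
   demands. *)
pose t := 6 * (D + 4 * delta); pose kap := 73 * H * (D + 4 * delta).
have Dd : (0 : R) < D + 4 * delta by rewrite addr_gt0 // mulr_gt0.
have t0 : (0 : R) < t by rewrite mulr_gt0.
have kap0 : (0 : R) <= kap by rewrite !mulr_ge0 // ltW.
have K1 : (1 : R) <= K.
  apply: mulr_ege1; first by apply: exprn_ege1; rewrite ler1n.
  by rewrite -[leLHS]expR0 ler_expR.
have N_doubling : (size (displ_ball prop x (10 * t)))%:R <=
    K * (size (displ_ball prop x (5 * t)))%:R.
  apply: (displ_ball_doubling hyp iso (ltW C0) dl0 cocompact) (ent x) _ => //.
    by rewrite /t; move: D0 delta0; lra.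
  rewrite /t /kap; have := mulr_gt0 H0 Dd.
  have -> : H * (10 * (6 * (D + 4 * delta))) = 60 * (H * (D + 4 * delta)) by ring.
  have -> : 73 * H * (D + 4 * delta) = 73 * (H * (D + 4 * delta)) by ring.
  by move: (H * _) => z; lra.
pose A := [set h : Gam | d x (act h x) <= 5 * t].
have A_card : card_is A (size (displ_ball prop x (5 * t))) by exact: card_displ_ball.
have N_gt0 : (0 < size (displ_ball prop x (5 * t)))%N.
  by apply: (displ_ball_gt0 hyp iso); rewrite mulr_ge0 // ltW.
have [nu' [_ /(_ Gam A A _ _ A_card A_card N_gt0 N_gt0)]] := bgt K K1.
case.
  pose AA := [seq h : {classic Gam} <- displ_ball prop x (10 * t) | `[< prodset A A h >]].
  exists (size AA); split.
    apply/card_isP; exists AA; split => //; first by rewrite filter_uniq ?displ_ball_uniq.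
    move=> h; rewrite (@mem_filter {classic Gam}) mem_displ_ball.
    split=> [AAh|/andP[/asboolP]//]; apply/andP; split; first exact/asboolP.
    have [a [b [Aa [Ab ->]]]] := AAh.
    apply: le_trans (displ_mul hyp iso _ _ _) _.
    have -> : 10 * t = 5 * t + 5 * t by ring.
    exact: lerD.
  rewrite -mulrA -expr2 sqr_sqrtr ?ler0n //; apply: le_trans N_doubling.
  by rewrite ler_nat size_filter count_size.
move=> G0 [L [sG0 [nL [fL [cov [nil _]]]]]].
(* Centring the [n.+1] exponents at [m] keeps their absolute values at most [m], about half of [n];
   this yields the factor 2 in the numerator of the bound. *)
rewrite -/n in cov; clearbody n; pose m := n.+1./2.
have lm : m%:R * l <= 5 * D + delta.
  have l0 : (0 : R) <= l by exact (displacement_ge0 hyp iso p g).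
  move: small; rewrite ler_pdivlMr; last by rewrite ltr_wpDl.
  have : (2 * m)%:R * l <= (n.+1)%:R * l by rewrite ler_wpM2r // ler_nat leq_double_half_succ.
  have -> : (2 * m)%:R * l = 2 * (m%:R * l) by rewrite natrM mulrA.
  have -> : n.+1%:R * l = n%:R * l + l by rewrite -natr1 mulrDl mul1r.
  have -> : l * (n%:R + 2) = n%:R * l + 2 * l by rewrite mulrDr [l * _]mulrC [l * 2]mulrC.
  by move: l0; move: (m%:R * l) (n%:R * l) => u v; lra.
(* The error of [axis_point] is [4 * delta + 4 * D] here, since the cocompactness constant is
   [2 * D]. *)
have near (k : int) : (`|k| <= m)%N -> d x (act (gzpow g k) x) <= 9 * D + 5 * delta.
  move=> km; rewrite (dist_gzpow_abs hyp iso).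
  have := xP `|k|%N; rewrite -/l.
  have : `|k|%N%:R * l <= m%:R * l.
    by rewrite ler_wpM2r ?ler_nat // (displacement_ge0 hyp iso).
  by move: lm D0 delta0; move: (_ * l) (_ * l) => u v; lra.
have idx i : (i <= n)%N -> (`|(Posz i - Posz m)%R| <= m)%N by exact: dist_half_succ_le.
have shift a b : - (Posz a - Posz m) + (Posz b - Posz m) = Posz b - Posz a.
  by rewrite opprB addrC addrA subrK.
have nz a b : (a < b)%N -> Posz b - Posz a != 0.
  by move=> ab; rewrite subr_eq0 eqz_nat gtn_eqF.
have [i [j [ij jn gG0]]] : exists i j, [/\ (i < j)%N, (j <= n)%N &
    G0 (gmul (ginv (gzpow g (Posz i - Posz m))) (gzpow g (Posz j - Posz m)))].
  apply: (covered_pigeonhole sG0 cov) => i /idx/near.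
  by rewrite /A /= /t; move: D0 delta0; lra.
(* The factor [s] stands on the right so that the quotient of two such elements is the conjugate of
   a power of [g] by [ginv s]. *)
have [i' [j' [ij' jn' sG0']]] : exists i j, [/\ (i < j)%N, (j <= n)%N &
    G0 (gmul (ginv (gmul (gzpow g (Posz i - Posz m)) s))
             (gmul (gzpow g (Posz j - Posz m)) s))].
  apply: (@covered_pigeonhole _ A G0 n (fun i => gmul (gzpow g (Posz i - Posz m)) s)) => //.
  move=> k /idx/near kD; rewrite /A /= /t.
  apply: le_trans (displ_mul hyp iso _ _ _) _.
  by move: kD sD D0 delta0; lra.
have G0E : G0 `<=` commens g.
  apply: (@nilpotent_mod_sub_commens _ g g_oo F FP G0 L (Posz j - Posz i)) => //.
    exact: nz.
  by move: gG0; rewrite -gzpowN -gzpowD shift.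
have conj_E : commens g (gmul (gmul (ginv s) (gzpow g (Posz j' - Posz i'))) (ginv (ginv s))).
  apply: G0E; move: sG0'; rewrite ginvM ginvK -!gmulA.
  by rewrite (gmulA (ginv (gzpow _ _))) -gzpowN -gzpowD shift.
have sE : commens g (ginv s).
  apply: (gzpow_conj_commens (nz _ _ ij')).
  apply: (commens_power FP) => //.
  by apply/conj_infinite_order/gzpow_infinite_order => //; exact: nz.
apply: sNE; rewrite -(ginvK s).
by have [_ [_ EV]] := commens_subgroup g; exact: EV.
Qed.
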